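(* For every epistemic state $(K,w)$, there is an attention state $(M,v)$ such that for all $\varphi\in\mathcal{L}_\Phi$, $(K,w)\vDash\varphi$ iff $(M,v)\vDash\varphi$.
   Context: Language. $I\neq\emptyset$ is a finite set of agents, $N\in\mathbb{N}$ an attention bound, $\Phi$ a countable set of proposition atoms, $\Psi=\{(\alpha_i<n),(\alpha_i=n): n\le N, i\in I\}$ the set of attention atoms, $At=\Phi\uplus\Psi$. The language $\mathcal{L}$ is $\varphi::=\top\mid p\mid\neg\varphi\mid\varphi\wedge\varphi\mid K_i\varphi$ with $p\in At$, $i\in I$. $\mathcal{L}_\Phi\subseteq\mathcal{L}$ is the sublanguage of formulas containing no attention atoms. Attention states. An attention model is $M=(W,R,V,A)$ with $W\ne\emptyset$ a finite set of worlds; $R$ assigning to each $i\in I$ an equivalence relation $R_i$ on $W$; $V:At\to\mathcal{P}(W)$ a valuation; and $A:I\times W\to\{0,\dots,N\}$ such that $wR_iv$ implies $A_i(w)=A_i(v)$. For $w\in W$, $(M,w)$ is an attention state. Satisfaction: $M,w\vDash p$ iff $w\in V(p)$ for $p\in\Phi$; $M,w\vDash(\alpha_i=n)$ iff $A_i(w)=n$; $M,w\vDash(\alpha_i<n)$ iff $A_i(w)<n$; $M,w\vDash K_i\varphi$ iff $M,v\vDash\varphi$ for all $v$ with $wR_iv$; standard clauses for $\top,\neg,\wedge$. Epistemic states. An epistemic Kripke model is $K=(W,R,V)$ with $W\neq\emptyset$ finite, $R$ assigning to each $i\in I$ an equivalence relation $R_i$ on $W$, and $V:At\to\mathcal{P}(W)$;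 for $w\in W$, $(K,w)$ is an epistemic state. Satisfaction of $\mathcal{L}$-formulas at epistemic states: $K,w\vDash p$ iff $w\in V(p)$ for all $p\in\Phi\cup\Psi$; $K,w\vDash K_i\varphi$ iff $K,v\vDash\varphi$ for all $v$ with $wR_iv$; standard clauses for $\top,\neg,\wedge$. *)

(* Defs.v *)
From mathcomp Require Import all_boot.

Set Implicit Arguments.
Unset Strict Implicit.
Unset Printing Implicit Defensive.

(* The bound n <= N on thresholds is carried by the type 'I_N.+1. *)
Inductive attention_atom (I : finType) (N : nat) : Type :=
| AttLt of I & 'I_N.+1   (* (alpha_i < n) *)
| AttEq of I & 'I_N.+1.  (* (alpha_i = n) *)

Definition atom (I : finType) (N : nat) (Phi : countType) : Type :=
  (Phi + attention_atom I N)%type.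

Inductive form (I : finType) (N : nat) (Phi : countType) : Type :=
| FTop
| FAtom of atom I N Phi
| FNot of form I N Phi
| FAnd of form I N Phi & form I N Phi
| FK of I & form I N Phi.

(* Membership in the sublanguage L_Phi. *)
Fixpoint attention_free (I : finType) (N : nat) (Phi : countType)
    (phi : form I N Phi) : bool :=
  match phi with
  | FTop => true
  | FAtom (inl _) => true
  | FAtom (inr _) => false
  | FNot psi => attention_free psi
  | FAnd psi chi => attention_free psi && attention_free chi
  | FK _ psi => attention_free psi
  end.

Record kripke_model (I : finType) (N : nat) (Phi : countType) := KripkeModel {
  k_world : finType;
  k_world_nonempty : 0 < #|k_world|;
  k_rel : I -> rel k_world;
  k_rel_equiv : forall i, equivalence_rel (k_rel i);
  k_val : atom I N Phi -> {set k_world}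
}.

Record attention_model (I : finType) (N : nat) (Phi : countType) :=
  AttentionModel {
  a_world : finType;
  a_world_nonempty : 0 < #|a_world|;
  a_rel : I -> rel a_world;
  a_rel_equiv : forall i, equivalence_rel (a_rel i);
  a_val : atom I N Phi -> {set a_world};
  a_att : I -> a_world -> 'I_N.+1;
  a_att_rel : forall i w v, a_rel i w v -> a_att i w = a_att i v
}.

Fixpoint k_sat (I : finType) (N : nat) (Phi : countType)
    (K : kripke_model I N Phi) (w : k_world K) (phi : form I N Phi) : Prop :=
  match phi with
  | FTop => True
  | FAtom p => w \in k_val K p
  | FNot psi => ~ k_sat w psi
  | FAnd psi chi => k_sat w psi /\ k_sat w chi
  | FK i psi => forall v : k_world K, k_rel i w v -> k_sat v psi
  end.

(* Attention atoms are interpreted by a_att; the value of a_val on them is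
   irrelevant. *)
Fixpoint a_sat (I : finType) (N : nat) (Phi : countType)
    (M : attention_model I N Phi) (w : a_world M) (phi : form I N Phi) : Prop :=
  match phi with
  | FTop => True
  | FAtom (inl p) => w \in a_val M (inl p)
  | FAtom (inr (AttLt i n)) => a_att i w < n
  | FAtom (inr (AttEq i n)) => a_att i w = n
  | FNot psi => ~ a_sat w psi
  | FAnd psi chi => a_sat w psi /\ a_sat w chi
  | FK i psi => forall v : a_world M, a_rel i w v -> a_sat v psi
  end.

(* Main.v *)
Require Import Defs.
From mathcomp Require Import all_boot.

(** The two semantics differ only at attention atoms, which formulas of the sublanguage never
    mention. So worlds, relations and valuation can be kept, and any attention function constant on
    each class turns the Kripke model into an attention model. The constant 0 is available for every
    bound [N] and makes the condition on related worlds trivial. *)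

Definition zero_attention (I : finType) (N : nat) (Phi : countType)
    (K : kripke_model I N Phi) : attention_model I N Phi :=
  @AttentionModel I N Phi (k_world K) (k_world_nonempty K) (@k_rel _ _ _ K)
    (@k_rel_equiv _ _ _ K) (@k_val _ _ _ K) (fun _ _ => ord0)
    (fun _ _ _ _ => erefl).

Lemma zero_attention_sat (I : finType) (N : nat) (Phi : countType)
    (K : kripke_model I N Phi) (phi : form I N Phi) (w : k_world K) :
  attention_free phi ->
  k_sat w phi <-> a_sat (w : a_world (zero_attention _ _ _ K)) phi.
Proof.
(* The world stays general because the case of [FK] uses the induction hypothesis at accessible
   worlds. Attention atoms contradict [attention_free]; other atoms share one valuation. *)
elim: phi w => [|[p|p]|psi IH|psi IHpsi chi IHchi|i psi IH] w //=.
- by move=> /(IH w) [ka ak]; split=> nsat; [move/ak | move/ka].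
- by case/andP=> /(IHpsi w) [? ?] /(IHchi w) [? ?]; split=> -[? ?]; split; auto.
- by move=> free; split=> sat v /sat; case: (IH v free); auto.
Qed.

Theorem proposition14 (I : finType) (I_nonempty : 0 < #|I|) (N : nat)
    (Phi : countType) (K : kripke_model I N Phi) (w : k_world K) :
  exists (M : attention_model I N Phi) (v : a_world M),
    forall phi : form I N Phi, attention_free phi ->
      (k_sat w phi <-> a_sat v phi).
Proof.
exists (zero_attention _ _ _ K), w => phi.
exact: zero_attention_sat.
Qed.
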